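(* Consider D$^2$/Exact-Diffusion with multiple gossip steps (defined in the context) for decentralized stochastic optimization with $n$ nodes, a symmetric doubly stochastic weight matrix $W$ of a strongly connected network, each $f_i$ convex and $L$-smooth, unbiased stochastic gradients with variance at most $\sigma^2$ and independent samples, $R=\lceil\frac{\ln(n)+4}{\sqrt{1-\beta}}\rceil$, and the learning rate (specified in the context) for which the algorithm has the guarantee, with $T=KR$, $$\frac1{K+1}\sum_{k=0}^K\big(\mathbb E f(\bar x^{(k)})-f(x^\star)\big)=O\Big(\frac{\sigma}{\sqrt{nT}}+\frac{\sigma^{2/3}\ln(n)^{1/3}}{n^{1/3}(1-\beta)^{1/6}T^{2/3}}+\frac{\ln(n)}{(1-\beta)^{1/2}T}\Big).$$ Then the transient stage of this algorithm is on the order of $\Omega\big(\frac{n\ln(n)^2}{1-\beta}\big)=\tilde\Omega\big(\frac n{1-\beta}\big)$.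
   Context: Problem: $f=\frac1n\sum_{i=1}^n f_i$ with $f_i(x)=\mathbb E_{\xi_i\sim D_i}F(x;\xi_i)$, $x\in\mathbb R^d$; $x^\star$ a minimizer of $f$. Eigenvalues of $W$: $1=\lambda_1(W)>\lambda_2(W)\ge\dots\ge\lambda_n(W)>-1$; $\beta=\max\{|\lambda_2(W)|,|\lambda_n(W)|\}<1$. Fast gossip: $\eta=\frac{1-\sqrt{1-\beta^2}}{1+\sqrt{1-\beta^2}}$, $M^{(-1)}=M^{(0)}=I$, $M^{(r+1)}=(1+\eta)WM^{(r)}-\eta M^{(r-1)}$; $M=M^{(R)}$; $\bar M=(1-\tau)M+\tau I$, $\tau=\frac1{2n}$. Algorithm: $x_i^{(0)}=0$, $\psi_i^{(0)}=x_i^{(0)}$; for $k=0,1,\dots$ every node $i$ draws $R$ independent samples $\xi_i^{(k,r)}\sim D_i$ and sets $g_i^{(k)}=\frac1R\sum_{r=1}^R\nabla F(x_i^{(k)};\xi_i^{(k,r)})$, $\psi_i^{(k+1)}=x_i^{(k)}-\gamma g_i^{(k)}$, $\phi_i^{(k+1)}=\psi_i^{(k+1)}+x_i^{(k)}-\psi_i^{(k)}$, $x_i^{(k+1)}=\sum_j\bar M_{ij}\phi_j^{(k+1)}$. $\bar x^{(k)}=\frac1n\sum_ix_i^{(k)}$; $K$ is the number of outer iterations and $T=KR$ the total number of samples (or gossip communications). Learning rate: $\gamma=\min\{\frac1{4L},\frac{(1-\tilde\beta)\tilde\lambda_n^{1/2}}{10L\tilde\lambda_2},(\frac{\tilde r_0}{\tilde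 r_1(K+1)})^{1/2},(\frac{\tilde r_0}{\tilde r_2(K+1)})^{1/3},(\frac{\tilde r_0}{\tilde r_3})^{1/3}\}$, where $\tilde\sigma^2=\sigma^2/R$, $\tilde\lambda_2=\lambda_2(\bar M)$, $\tilde\lambda_n=\lambda_n(\bar M)$, $\tilde\beta_1=\sqrt{\tilde\lambda_2}$, $\tilde\beta=\max\{|\lambda_2(M)|,|\lambda_n(M)|\}$, $\tilde r_0=2\mathbb E\|\bar x^{(0)}-x^\star\|^2$, $\tilde r_1=\frac{2\tilde\sigma^2}n$, $\tilde r_2=\frac{24L\tilde\lambda_2^2\tilde\sigma^2}{(1-\tilde\beta_1)\tilde\lambda_n}$, $\tilde r_3=\frac{9L\tilde\lambda_2^2}{(1-\tilde\beta_1)(1-\tilde\beta)\tilde\lambda_n}$. Transient stage: the number $T$ needed to reach the linear-speedup stage, i.e. the order of the smallest $T$ from which on the term of the rate bound involving $nT$, here $\frac{\sigma}{\sqrt{nT}}$, dominates each of the other terms of the bound up to absolute constants. The order is expressed in $n$ and $1-\beta$, with $\sigma>0$ treated as a constant; $\tilde\Omega$ hides logarithmic factors. *)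

(* Defs.v *)
From HB Require Import structures.
From mathcomp Require Import all_boot all_order all_algebra.
From mathcomp Require Import all_classical all_reals all_analysis.
Set Implicit Arguments.
Unset Strict Implicit.
Unset Printing Implicit Defensive.
Import Order.TTheory GRing.Theory Num.Theory.
Import numFieldNormedType.Exports.
Local Open Scope classical_set_scope.
Local Open Scope ring_scope.

Section Euclidean.
Context {R : realType} {d : nat}.

(* The library norm on row vectors is the sup norm, hence this definition. *)
Definition enorm (v : 'rV[R]_d) : R := Num.sqrt (\sum_(j < d) v 0 j ^+ 2).

Definition gradient (f : 'rV[R]_d -> R) (x : 'rV[R]_d) : 'rV[R]_d :=
  \row_(j < d) 'D_(delta_mx 0 j) f x.

Definition differentiable_everywhere (f : 'rV[R]_d -> R) : Prop :=
  forall x, differentiable f x.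

Definition L_smooth (L : R) (f : 'rV[R]_d -> R) : Prop :=
  differentiable_everywhere f /\
  forall x y, enorm (gradient f x - gradient f y) <= L * enorm (x - y).

End Euclidean.

Section Spectrum.
Context {R : realType} {n : nat}.
Implicit Type A : 'M[R]_n.

(* The eigenvalues of A in nonincreasing order, with multiplicities: the
   sequence exists for symmetric A, and is unique by spectrum_eq. *)
Definition spectrum A : seq R :=
  xget [::] [set s : seq R | sorted (fun a b => b <= a) s
                             /\ char_poly A = \prod_(a <- s) ('X - a%:P)].

Lemma spectrum_eq A (s : seq R) :
    sorted (fun a b => b <= a) s -> char_poly A = \prod_(a <- s) ('X - a%:P) ->
  spectrum A = s.
Proof.
move=> s_sorted As; rewrite /spectrum; case: xgetP => [t _ [t_sorted At]|].
  apply: (@sorted_eq _ (fun a b : R => b <= a)) => //.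
  - by move=> y x z yx zy; exact: le_trans zy yx.
  - by move=> x y /andP[yx xy]; apply/eqP; rewrite eq_le xy yx.
  - by apply: prod_XsubC_eq; rewrite -At -As.
by move=> /(_ s); case.
Qed.

(* Numbered from 1, so that lambda 1 A is the largest eigenvalue. *)
Definition lambda (k : nat) A : R := nth 0 (spectrum A) k.-1.

Definition mixing_rate A : R := Num.max `|lambda 2 A| `|lambda n A|.

End Spectrum.

Section Gossip.
Context {R : realType} {n : nat}.
Variable W : 'M[R]_n.

Definition doubly_stochastic : Prop :=
  [/\ forall i j, 0 <= W i j,
      forall i, \sum_j W i j = 1 &
      forall j, \sum_i W i j = 1].

Definition strongly_connected_network : Prop :=
  forall i j, connect (fun a b => 0 < W a b) i j.

Definition momentum : R :=
  let s := Num.sqrt (1 - mixing_rate W ^+ 2) in (1 - s) / (1 + s).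

(* The pair (M^(r-1), M^(r)). *)
Fixpoint fast_gossip (r : nat) : 'M[R]_n * 'M[R]_n :=
  match r with
  | 0 => (1%:M, 1%:M)
  | r'.+1 => let: (Mprev, Mcur) := fast_gossip r' in
      (Mcur, (1 + momentum) *: (W *m Mcur) - momentum *: Mprev)
  end.

Definition gossip_rounds : nat :=
  `|Num.ceil ((ln n%:R + 4) / Num.sqrt (1 - mixing_rate W))|%N.

Definition gossip_matrix : 'M[R]_n := (fast_gossip gossip_rounds).2.

Definition damping : R := (2 * n%:R)^-1.

Definition damped_gossip_matrix : 'M[R]_n :=
  (1 - damping) *: gossip_matrix + damping *: 1%:M.

End Gossip.

Record setting (R : realType) := Setting {
  nodes : nat;
  dim : nat;
  weights : 'M[R]_nodes;
  sample_display : measure_display;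
  sample_type : measurableType sample_display;
  data_law : 'I_nodes -> probability sample_type R;
  loss : 'rV[R]_dim -> sample_type -> R;
  smoothness : R;
  noise : R;
  xstar : 'rV[R]_dim;
  run_display : measure_display;
  run_type : measurableType run_display;
  run_law : probability run_type R;
  (* sample i k r is the r-th sample drawn by node i at outer iteration k *)
  sample : 'I_nodes -> nat -> 'I_(gossip_rounds weights) ->
           run_type -> sample_type
}.

Section Setting.
Context {R : realType}.
Variable S : setting R.
Local Notation n := (nodes S).
Local Notation d := (dim S).
Local Notation W := (weights S).
Local Notation L := (smoothness S).
Local Notation sigma := (noise S).
Local Notation rounds := (gossip_rounds W).

Definition beta : R := mixing_rate W.

Definition local_objective (i : 'I_n) (x : 'rV[R]_d) : R :=
  fine ('E_(data_law i)[loss x])%E.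

Definition objective (x : 'rV[R]_d) : R :=
  n%:R^-1 * \sum_(i < n) local_objective i x.

Definition stochastic_gradient (x : 'rV[R]_d) (s : sample_type S) : 'rV[R]_d :=
  gradient (fun y => loss y s) x.

Definition network_assumption : Prop :=
  [/\ (1 < n)%N,
      W^T = W,
      doubly_stochastic W,
      strongly_connected_network W &
      [/\ lambda 1 W = 1, lambda 2 W < 1 & -1 < lambda n W]].

Definition objective_assumption : Prop :=
  [/\ 0 < L,
      forall (i : 'I_n) (x : 'rV[R]_d),
        (data_law i).-integrable setT (EFin \o loss x),
      forall i : 'I_n, convex_function setT (local_objective i),
      forall i : 'I_n, L_smooth L (local_objective i) &
      forall x, objective (xstar S) <= objective x].

Definition gradient_noise_assumption : Prop :=
  [/\ forall s : sample_type S,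
        differentiable_everywhere (fun x => loss x s),
      forall (i : 'I_n) x j,
        ('E_(data_law i)[fun s => (stochastic_gradient x s 0 j)%R]
         = (gradient (local_objective i) x 0%R j)%:E)%E &
      forall (i : 'I_n) x,
        ('E_(data_law i)[fun s => (enorm (stochastic_gradient x s
                                   - gradient (local_objective i) x) ^+ 2)%R]
         <= (sigma ^+ 2)%:E)%E].

Definition sampling_assumption : Prop :=
  [/\ forall i k r, measurable_fun setT (@sample R S i k r),
      forall i k r (A : set (sample_type S)), measurable A ->
        run_law S (@sample R S i k r @^-1` A) = data_law i A &
      forall (J : seq ('I_n * nat * 'I_rounds))
             (A : 'I_n * nat * 'I_rounds -> set (sample_type S)),
        uniq J -> (forall t, measurable (A t)) ->
        run_law S [set w | forall t, t \in J ->
                             A t (@sample R S t.1.1 t.1.2 t.2 w)]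
        = (\prod_(t <- J) run_law S (@sample R S t.1.1 t.1.2 t.2 @^-1` A t))%E].

Definition standing_assumptions : Prop :=
  [/\ network_assumption, objective_assumption,
      gradient_noise_assumption & sampling_assumption].

Definition minibatch_gradient (k : nat) (w : run_type S)
    (x : 'I_n -> 'rV[R]_d) (i : 'I_n) : 'rV[R]_d :=
  rounds%:R^-1 *:
    \sum_(r < rounds) stochastic_gradient (x i) (sample i k r w).

(* The pair (x^(k), psi^(k)) along the run w, with learning rate gamma. *)
Fixpoint exact_diffusion (gamma : R) (w : run_type S) (k : nat) :
    ('I_n -> 'rV[R]_d) * ('I_n -> 'rV[R]_d) :=
  match k with
  | 0 => (fun=> 0, fun=> 0)
  | k'.+1 =>
      let: (x, psi) := exact_diffusion gamma w k' in
      let psi' i := x i - gamma *: minibatch_gradient k' w x i in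
      let phi' i := psi' i + x i - psi i in
      (fun i => \sum_(j < n) damped_gossip_matrix W i j *: phi' j, psi')
  end.

Definition iterate gamma w k : 'I_n -> 'rV[R]_d := (exact_diffusion gamma w k).1.

Definition mean_iterate gamma w k : 'rV[R]_d :=
  n%:R^-1 *: \sum_(i < n) iterate gamma w k i.

Definition learning_rate (K : nat) : R :=
  let sigma2 := sigma ^+ 2 / rounds%:R in
  let lambda2 := lambda 2 (damped_gossip_matrix W) in
  let lambdan := lambda n (damped_gossip_matrix W) in
  let beta1 := Num.sqrt lambda2 in
  let betat := mixing_rate (gossip_matrix W) in
  (* the initial mean iterate is deterministic and equal to 0 *)
  let r0 := 2 * enorm (0 - xstar S) ^+ 2 in
  let r1 := 2 * sigma2 / n%:R in
  let r2 := 24 * L * lambda2 ^+ 2 * sigma2 / ((1 - beta1) * lambdan) in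
  let r3 := 9 * L * lambda2 ^+ 2 / ((1 - beta1) * (1 - betat) * lambdan) in
  Num.min ((4 * L)^-1)
    (Num.min ((1 - betat) * Num.sqrt lambdan / (10 * L * lambda2))
      (Num.min (Num.sqrt (r0 / (r1 * K.+1%:R)))
        (Num.min ((r0 / (r2 * K.+1%:R)) `^ 3^-1)
                 ((r0 / r3) `^ 3^-1)))).

Definition mean_optimality_gap (K : nat) : \bar R :=
  ((K.+1%:R^-1)%:E *
   \sum_(0 <= k < K.+1)
     ('E_(run_law S)[fun w => objective (mean_iterate (learning_rate K) w k)]
      - (objective (xstar S))%:E))%E.

End Setting.

(* A rate bound as a function of the number T of samples: the sum of the term
   responsible for linear speedup and of the remaining terms. *)
Record rate_bound (R : realType) := RateBound {
  speedup_term : nat -> R;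
  other_terms : seq (nat -> R)
}.

Definition rate_value (R : realType) (b : rate_bound R) (T : nat) : R :=
  speedup_term b T + \sum_(t <- other_terms b) t T.

Section Rate.
Context {R : realType}.
Variable S : setting R.
Local Notation n := ((nodes S)%:R : R).
Local Notation sigma := (noise S).
Local Notation rounds := (gossip_rounds (weights S)).

Definition exact_diffusion_rate : rate_bound R := {|
  speedup_term T := sigma / Num.sqrt (n * T%:R);
  other_terms :=
    [:: (fun T => sigma `^ (2 / 3) * ln n `^ 3^-1 /
           (n `^ 3^-1 * (1 - beta S) `^ 6^-1 * T%:R `^ (2 / 3)));
        (fun T => ln n / (Num.sqrt (1 - beta S) * T%:R))]
|}.

(* The constant C hidden in the O notation (which absorbs smoothness S and
   xstar S) is only required to be independent of K: as a hypothesis this is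
   weaker than a constant that is uniform over all problems and networks. *)
Definition rate_guarantee : Prop :=
  exists2 C : R, 0 < C & forall K : nat, (0 < K)%N ->
    (mean_optimality_gap S K
     <= (C * rate_value exact_diffusion_rate (K * rounds))%:E)%E.

(* Numbers of samples (or gossip communications) used by complete outer
   iterations. *)
Definition sample_count (T : nat) : Prop :=
  exists2 K : nat, (0 < K)%N & T = (K * rounds)%N.

Definition linear_speedup_from (kappa : R) (b : rate_bound R) (T : nat) : Prop :=
  forall T', sample_count T' -> (T <= T')%N ->
    all (fun t => t T' <= kappa * speedup_term b T') (other_terms b).

(* The least T from which on the speedup term dominates all the other terms up
   to the factor kappa (0 when there is none). *)
Definition transient_stage (kappa : R) : nat :=
  xget 0%N [set T | [/\ sample_count T,
    linear_speedup_from kappa exact_diffusion_rate T &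
    forall T', sample_count T' ->
      linear_speedup_from kappa exact_diffusion_rate T' -> (T <= T')%N]].

End Rate.

Section Order.
Context {R : realType} {I : Type}.
Variables (D : I -> Prop).

Definition same_order (h g : I -> R) : Prop :=
  exists a b : R, [/\ 0 < a, 0 < b &
    forall i, D i -> a * g i <= h i <= b * g i].

Definition same_order_up_to_log (m : I -> nat) (h g : I -> R) : Prop :=
  exists (a b : R) (p : nat), [/\ 0 < a, 0 < b &
    forall i, D i ->
      a * g i / ln (m i)%:R ^+ p <= h i <= b * g i * ln (m i)%:R ^+ p].

End Order.

(* Main.v *)
(** Multiplying out, either remaining term is at most [kappa] times
    [sigma / sqrt (n T)] iff [T >= c * n (ln n)^2 / (1 - beta)], where
    [c = 1 / (kappa^6 sigma^2)] for the first term and [1 / (kappa sigma)^2] for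
    the second one.  So the transient stage is the least positive multiple of [R] above
    such a threshold; it exceeds the threshold by at most [R], which is itself
    [O(n (ln n)^2 / (1 - beta))] because [ln n >= ln 2] and [0 < 1 - beta <= 1]. *)
Require Import Defs.
From HB Require Import structures.
From mathcomp Require Import all_boot all_order all_algebra.
From mathcomp Require Import all_classical all_reals all_analysis.
From mathcomp Require Import ring lra.
Import Order.TTheory GRing.Theory Num.Theory.
Import numFieldNormedType.Exports.
Local Open Scope ring_scope.

Lemma powR_exprn (R : realType) (x y : R) (k m : nat) :
  0 <= x -> y * k%:R = m%:R -> (x `^ y) ^+ k = x ^+ m.
Proof.
by move=> x_ge0 ykm; rewrite -powR_mulrn ?powR_ge0// -powRrM ykm powR_mulrn.
Qed.

(** Six is a common multiple of the denominators of [2 / 3], [3^-1], [6^-1] and of the square root,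
    so comparing sixth powers of the two nonnegative sides leaves only integer powers. *)
Lemma variance_term_le (R : realType) (kappa sigma l n b t : R) :
  0 < kappa -> 0 < sigma -> 0 < l -> 0 < n -> 0 < b -> 0 < t ->
  (sigma `^ (2 / 3) * l `^ 3^-1 / (n `^ 3^-1 * b `^ 6^-1 * t `^ (2 / 3))
     <= kappa * (sigma / Num.sqrt (n * t)))
  = ((kappa ^+ 6 * sigma ^+ 2)^-1 * (n * l ^+ 2 / b) <= t).
Proof.
move=> kappa_gt0 sigma_gt0 l_gt0 n_gt0 b_gt0 t_gt0.
have nt_gt0 : 0 < n * t by rewrite mulr_gt0.
have sqrt_gt0 : 0 < Num.sqrt (n * t) by rewrite sqrtr_gt0.
rewrite -(@ler_pXn2r _ 6) ?nnegrE//; first last.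
- by rewrite !mulr_ge0 ?invr_ge0// ltW.
- by rewrite !mulr_ge0 ?invr_ge0 ?mulr_ge0 ?powR_ge0.
rewrite !exprMn !exprVn !exprMn.
rewrite (@powR_exprn _ sigma _ 6 4 (ltW _))//; last by field.
rewrite (@powR_exprn _ l _ 6 2 (ltW _))//; last by field.
rewrite (@powR_exprn _ n _ 6 2 (ltW _))//; last by field.
rewrite (@powR_exprn _ b _ 6 1 (ltW _))//; last by field.
rewrite (@powR_exprn _ t _ 6 4 (ltW _))//; last by field.
rewrite (exprM (Num.sqrt _) 2 3) sqr_sqrtr ?(ltW nt_gt0)//.
(* Chosen so that [c * t] is the sixth power of the right-hand side; [c] times the threshold is then
   that of the left-hand side. *)
pose c := sigma ^+ 6 * kappa ^+ 6 / (n ^+ 3 * t ^+ 4).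
have c_gt0 : 0 < c by rewrite divr_gt0 ?mulr_gt0 ?exprn_gt0.
rewrite -[in RHS](ler_pM2l c_gt0) /c; congr (_ <= _); field.
- by rewrite !gt_eqF.
- by rewrite !gt_eqF.
Qed.

(** Same method as for the first term; here only square roots occur, so squaring is enough. *)
Lemma bias_term_le (R : realType) (kappa sigma l n b t : R) :
  0 < kappa -> 0 < sigma -> 0 < l -> 0 < n -> 0 < b -> 0 < t ->
  (l / (Num.sqrt b * t) <= kappa * (sigma / Num.sqrt (n * t)))
  = ((kappa ^+ 2 * sigma ^+ 2)^-1 * (n * l ^+ 2 / b) <= t).
Proof.
move=> kappa_gt0 sigma_gt0 l_gt0 n_gt0 b_gt0 t_gt0.
have nt_gt0 : 0 < n * t by rewrite mulr_gt0.
have sqrt_gt0 : 0 < Num.sqrt (n * t) by rewrite sqrtr_gt0.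
have sqrtb_gt0 : 0 < Num.sqrt b by rewrite sqrtr_gt0.
rewrite -(@ler_pXn2r _ 2) ?nnegrE//; first last.
- by rewrite !mulr_ge0 ?invr_ge0// ltW.
- by rewrite divr_ge0 ?mulr_ge0// ltW.
rewrite !exprMn !exprVn !exprMn !sqr_sqrtr; [|exact: ltW..].
pose c := sigma ^+ 2 * kappa ^+ 2 / (n * t ^+ 2).
have c_gt0 : 0 < c by rewrite divr_gt0 ?mulr_gt0 ?exprn_gt0.
rewrite -[in RHS](ler_pM2l c_gt0) /c; congr (_ <= _); field.
- by rewrite !gt_eqF.
- by rewrite !gt_eqF.
Qed.

Lemma mixing_rate_lt1 (R : realType) (n : nat) (A : 'M[R]_n) :
  (1 < n)%N -> lambda 1 A = 1 -> lambda 2 A < 1 -> -1 < lambda n A ->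
  mixing_rate A < 1.
Proof.
move=> n_gt1; rewrite /mixing_rate /lambda.
case: n A n_gt1 => [|[|n]]//= A _.
(* If no sorted list of roots existed, the spectrum would be the default [[::]] and [lambda 1 A]
   would be 0 instead of 1. *)
rewrite /spectrum; case: xgetP => [s _ [s_sorted As] _ lt1 gtN1|_ /=]; last first.
  by move=> /esym/eqP; rewrite oner_eq0.
have size_s : size s = n.+2.
  by have := size_char_poly A; rewrite As size_prod_XsubC => -[].
(* The ordering supplies the two missing one-sided bounds: the second eigenvalue exceeds -1 and the
   last one is below 1. *)
have le21 : s`_n.+1 <= s`_1.
  apply: (@sorted_leq_nth _ (fun a b : R => b <= a)) => //.
  - by move=> y x z yx zy; exact: le_trans zy yx.
  - by rewrite inE size_s.
  - by rewrite inE size_s.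
by rewrite gt_max !ltr_norml; lra.
Qed.

Lemma beta_bounds (R : realType) (S : setting R) :
  network_assumption S -> 0 <= beta S < 1.
Proof.
case=> n_gt1 _ _ _ [l1 l2 ln_]; rewrite /beta mixing_rate_lt1// andbT.
by rewrite le_max normr_ge0.
Qed.

Lemma gossip_rounds_bounds (R : realType) (n : nat) (W : 'M[R]_n) :
  (1 < n)%N -> 0 <= mixing_rate W < 1 ->
  let l := ln n%:R : R in
  1 <= (gossip_rounds W)%:R :> R /\
  (gossip_rounds W)%:R <= (l + 5) / (1 - mixing_rate W).
Proof.
move=> n_gt1 /andP[beta_ge0 beta_lt1] l.
set b := 1 - _.
have b_gt0 : 0 < b by rewrite subr_gt0.
have b_le1 : b <= 1 by rewrite /b; lra.
have l_gt0 : 0 < l by rewrite ln_gt0// ltr1n.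
have sqrt_gt0 : 0 < Num.sqrt b by rewrite sqrtr_gt0.
rewrite /gossip_rounds -/b -/l; set x := (_ / _).
have x_gt0 : 0 < x by rewrite divr_gt0// addr_gt0.
have ceil_gt0 : 0 < Num.ceil x by rewrite ceil_gt0.
rewrite natr_absz gtr0_norm//; split.
  by rewrite ler1z -gtz0_ge1.
(* Rounding up costs at most 1, which is at most [b^-1]; this turns [l + 4] into [l + 5]. *)
have ceil_le : (Num.ceil x)%:~R <= x + 1 by have := ceilB1_lt x; lra.
apply: (le_trans ceil_le).
have b_le_sqrt : b <= Num.sqrt b.
  rewrite -[leLHS](sqr_sqrtr (ltW b_gt0)) expr2 -[leRHS]mulr1 ler_pM2l//.
  by rewrite -sqrtr1 ler_wsqrtr.
have inv_le : (Num.sqrt b)^-1 <= b^-1 by rewrite lef_pV2 ?posrE.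
have inv_ge1 : 1 <= b^-1 by rewrite invf_ge1.
rewrite /x; nra.
Qed.

Section TransientStage.
Variables (R : realType) (S : setting R) (kappa c : R).
Local Notation T := (transient_stage S kappa).
Local Notation r := (gossip_rounds (weights S)).
Hypothesis r_gt0 : (0 < r)%N.
Hypothesis c_ge0 : 0 <= c.
Hypothesis dominatedE : forall t, (0 < t)%N ->
  all (fun f => f t <= kappa * speedup_term (exact_diffusion_rate S) t)
    (other_terms (exact_diffusion_rate S)) = (c <= t%:R).

(** The stage equals [K * r] for the least positive [K] with [c <= K * r]: by minimality, one block
    of [r] samples fewer falls below [c]. *)
Lemma transient_stage_bounds : c <= T%:R <= c + r%:R.
Proof.
have count_gt0 t : sample_count S t -> (0 < t)%N.
  by case=> K K_gt0 ->; rewrite muln_gt0 K_gt0.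
(* The condition [c <= t] is upward closed, so domination from [t] on reduces to domination at [t]
   itself. *)
have fromE t : sample_count S t ->
    linear_speedup_from S kappa (exact_diffusion_rate S) t <-> c <= t%:R.
  move=> t_count; split=> [from_t|ct t' t'_count tt'].
    by rewrite -dominatedE ?count_gt0//; exact: from_t.
  by rewrite dominatedE ?count_gt0// (le_trans ct)// ler_nat.
have ex_K : exists K, (0 < K)%N && (c <= (K * r)%:R).
  exists (Num.truncn c).+1; rewrite /= (le_trans (ltW (truncnS_gt c)))//.
  by rewrite ler_nat leq_pmulr.
have [K /andP[K_gt0 cK] K_min] := ex_minnP ex_K.
rewrite /transient_stage; case: xgetP => [t _ [t_count t_from t_min]|none].
  have -> : t = (K * r)%N.
    have Kr_count : sample_count S (K * r) by exists K.
    apply/eqP; rewrite eqn_leq t_min ?fromE//=.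
    move: t_count t_from => [K' K'_gt0 ->]; rewrite fromE; last by exists K'.
    by move=> cK'; rewrite leq_mul2r K_min ?orbT// K'_gt0.
  (* For [K = 1] no smaller admissible count exists, and the upper bound comes from [0 <= c]. *)
  rewrite cK /=; case: K K_gt0 cK K_min => [//|[|K]] _ cK K_min.
    by rewrite mul1n lerDr.
  rewrite mulSn natrD addrC lerD2r leNgt; apply/negP => lt_cK.
  by have := K_min K.+1; rewrite /= ltnn => /(_ (ltW lt_cK)).
(* The default value 0 of [xget] is ruled out, since [K * r] meets the specification. *)
exfalso; apply: (none (K * r)%N); split; first by exists K.
  by rewrite fromE//; exists K.
move=> _ [K' K'_gt0 ->]; rewrite fromE; last by exists K'.
by move=> cK'; rewrite leq_mul2r K_min ?orbT// K'_gt0.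
Qed.

End TransientStage.

Lemma dominated_by_speedupE (R : realType) (S : setting R) (kappa : R) (t : nat) :
  network_assumption S -> 0 < kappa -> 0 < noise S -> (0 < t)%N ->
  all (fun f => f t <= kappa * speedup_term (exact_diffusion_rate S) t)
    (other_terms (exact_diffusion_rate S))
  = (Num.max (kappa ^+ 6 * noise S ^+ 2)^-1 (kappa ^+ 2 * noise S ^+ 2)^-1
     * ((nodes S)%:R * ln (nodes S)%:R ^+ 2 / (1 - beta S)) <= t%:R).
Proof.
move=> netS kappa_gt0 sigma_gt0 t_gt0.
have /andP[beta_ge0 beta_lt1] := beta_bounds _ _ netS; case: netS => n_gt1 _ _ _ _.
have b_gt0 : 0 < 1 - beta S by rewrite subr_gt0.
have l_gt0 : 0 < ln (nodes S)%:R :> R by rewrite ln_gt0// ltr1n.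
have n_gt0 : 0 < (nodes S)%:R :> R by rewrite ltr0n ltnW.
have t_gt0' : 0 < t%:R :> R by rewrite ltr0n.
rewrite /= andbT variance_term_le// bias_term_le// maxr_pMl ?ge_max//.
by rewrite ltW// divr_gt0// mulr_gt0// exprn_gt0.
Qed.

Lemma transient_stage_order (R : realType) (sigma kappa : R) :
  0 < sigma -> 0 < kappa ->
  exists a b : R, [/\ 0 < a, 0 < b & forall S : setting R,
    network_assumption S -> noise S = sigma ->
    a * ((nodes S)%:R * ln (nodes S)%:R ^+ 2 / (1 - beta S))
      <= (transient_stage S kappa)%:R
      <= b * ((nodes S)%:R * ln (nodes S)%:R ^+ 2 / (1 - beta S))].
Proof.
move=> sigma_gt0 kappa_gt0.
pose u : R := ln 2.
have u_gt0 : 0 < u by rewrite ln_gt0// ltr1n.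
pose a := Num.max (kappa ^+ 6 * sigma ^+ 2)^-1 (kappa ^+ 2 * sigma ^+ 2)^-1.
have a_gt0 : 0 < a by rewrite lt_max invr_gt0 mulr_gt0 ?exprn_gt0.
(* The first [a] accounts for the threshold [a * g], the rest for the extra block of [r] samples:
   [l + 5] is at most [(u^-1 + 5 * u^-1 ^+ 2) * l ^+ 2], because [l / u >= 1]. *)
exists a, (a + (u^-1 + 5 * u^-1 ^+ 2)); split=> //.
  by rewrite !addr_gt0 ?mulr_gt0 ?exprn_gt0 ?invr_gt0.
move=> S netS sigmaS; set g := (nodes S)%:R * _ / _.
have bS := beta_bounds _ _ netS; have [n_gt1 _ _ _ _] := netS.
have [r_ge1 r_le] := @gossip_rounds_bounds _ _ (weights S) n_gt1 bS.
move: bS => /andP[beta_ge0 beta_lt1].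
have b_gt0 : 0 < 1 - beta S by rewrite subr_gt0.
have n_ge1 : 1 <= (nodes S)%:R :> R by rewrite ler1n ltnW.
have u_le : u <= ln (nodes S)%:R.
  by rewrite ler_ln ?posrE ?ltr0n ?ler_nat// ltnW.
have g_ge0 : 0 <= g.
  by rewrite divr_ge0 ?mulr_ge0 ?exprn_ge0 ?(ltW b_gt0)// ltW// (lt_le_trans u_gt0).
have := @transient_stage_bounds _ S kappa (a * g).
case/(_ _ _ _)/andP.
- by rewrite -(ltr0n R) (lt_le_trans ltr01).
- by rewrite mulr_ge0// ltW.
- by move=> t t_gt0; rewrite dominated_by_speedupE// sigmaS.
move=> -> /le_trans -> //; rewrite [leRHS]mulrDl lerD2l (le_trans r_le)//.
rewrite /g mulrA ler_pM2r ?invr_gt0//.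
set l := ln _ in u_le *; pose v := l / u.
have v_ge1 : 1 <= v by rewrite ler_pdivlMr// mul1r.
have -> : (u^-1 + 5 * u^-1 ^+ 2) * ((nodes S)%:R * l ^+ 2)
        = (nodes S)%:R * (v * l + 5 * v ^+ 2).
  by rewrite /v; field; rewrite gt_eqF.
have l_gt0 : 0 < l by exact: lt_le_trans u_le.
have le1 : l + 5 <= v * l + 5 * v ^+ 2 by nra.
by apply: (le_trans le1); rewrite ler_peMl//; nra.
Qed.

Theorem corollary3 (R : realType) (sigma kappa : R)
    (sigma_gt0 : 0 < sigma) (kappa_gt0 : 0 < kappa) :
  let runs := fun S : setting R =>
    [/\ standing_assumptions S, noise S = sigma & rate_guarantee S] in
  let transient := fun S : setting R => (transient_stage S kappa)%:R : R in
  same_order runs transient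
    (fun S => (nodes S)%:R * ln (nodes S)%:R ^+ 2 / (1 - beta S))
  /\
  same_order_up_to_log runs (@nodes R) transient
    (fun S => (nodes S)%:R / (1 - beta S)).
Proof.
have [a [b [a_gt0 b_gt0 order]]] :=
  transient_stage_order _ _ _ sigma_gt0 kappa_gt0.
move=> runs transient; split.
  by exists a, b; split=> // S [[netS _ _ _] sigmaS _]; exact: order.
have u_gt0 : 0 < ln 2 :> R by rewrite ln_gt0// ltr1n.
(* The power 2 makes the upper bound literally the previous one. The lower bound amounts to
   [ln 2 ^+ 4 <= ln n ^+ 4]; the factor [ln 2 ^+ 4] is there because [ln n < 1] when [n = 2]. *)
exists (a * ln 2 ^+ 4), b, 2%N; split=> //; first by rewrite mulr_gt0 ?exprn_gt0.
move=> S [[netS _ _ _] sigmaS _].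
have /andP[lo hi] := order S netS sigmaS.
have /andP[_ beta_lt1] := beta_bounds _ _ netS; have [n_gt1 _ _ _ _] := netS.
have n_gt0 : 0 < (nodes S)%:R :> R by rewrite ltr0n ltnW.
have u_le : ln 2 <= ln (nodes S)%:R :> R by rewrite ler_ln ?posrE ?ltr0n ?ler_nat// ltnW.
have l_gt0 : 0 < ln (nodes S)%:R :> R by exact: lt_le_trans u_le.
have g_ge0 : 0 <= (nodes S)%:R / (1 - beta S) by rewrite divr_ge0 ?subr_ge0// ltW.
apply/andP; split; last first.
  by move: hi; rewrite mulrAC mulrA.
apply: le_trans lo; rewrite [leRHS](_ : _ =
    a * ((nodes S)%:R / (1 - beta S)) * ln (nodes S)%:R ^+ 2); last by ring.
rewrite ler_pdivrMr ?exprn_gt0// -[leRHS]mulrA -exprD mulrAC.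
apply: ler_wpM2l; first by rewrite mulr_ge0// ltW.
by apply: lerXn2r => //; rewrite nnegrE ltW.
Qed.
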